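(* Let $d\ge 2$, let $K=K_1\times K_2\subset\mathbb{R}^d$ be a compact rectangle, and for each $n\ge 0$ let $(\psi_n,\tilde\psi_n)\in\mathcal{D}_K^0\times\mathcal{S}_{K_1}$ be such that $\psi_n$ is compatible with $\tilde\psi_n$ (i.e. $\psi_n$ can be written in the form (J) for the sequence of jumps of $\tilde\psi_n$). Assume that $(\psi_n,\tilde\psi_n)\to(\psi_0,\tilde\psi_0)$ as $n\to\infty$ in $\mathcal{D}_K^0\times\mathcal{S}_{K_1}$ with the product of the topologies given by $d_K$ and $d_{K_1}$. Suppose in addition that $\psi_0$ can be expressed as in (J) for the sequence $(\dots<a_{-k-1}<a_{-k}<\dots<a_0=0<\dots<a_k<a_{k+1}<\dots)$ of jumps of $\tilde\psi_0$ and some continuous functions $V_j:K_2\to\mathbb{R}$, $j\in\mathbb{Z}$, each having a unique maximizer on $K_2$, with the property that for every finite nonempty subset $A\subset\mathbb{Z}$ there is only one $j\in A$ for which $$\max_{m\in A}\Big\{\sup_{\xi\in K_2}V_m(\xi)\Big\}=\sup_{\xi\in K_2}V_j(\xi).$$ Finally, assume that $\psi_0$ has no jumps at the extreme points of $K_1$ (that is, no $a_k$ with $k\neq0$ is an endpoint of $K_1$). Then, as $n\to\infty$: (i) $\operatorname{sargmax}_{x\in K}\{\psi_n(x)\}\to\operatorname{sargmax}_{x\in K}\{\psi_0(x)\}$; (ii) $\operatorname{largmax}_{x\in K}\{\psi_n(x)\}\to\operatorname{largmax}_{x\in K}\{\psi_0(x)\}$. The result is also true when $d=1$, in the following form. Let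 $K=K_1\subset\mathbb{R}$ be a compact interval, and for each $n\ge0$ let $(\psi_n,\tilde\psi_n)\in\mathcal{D}_K^0\times\mathcal{S}_{K_1}$ be such that $\psi_n$ can be written in the form (J) for the sequence of jumps of $\tilde\psi_n$. Assume that $(\psi_n,\tilde\psi_n)\to(\psi_0,\tilde\psi_0)$ as $n\to\infty$ in $\mathcal{D}_K^0\times\mathcal{S}_{K_1}$ with the product of the topologies given by $d_K$ and $d_{K_1}$; that $\psi_0$ can be expressed as in (J) for the sequence $(a_k)_{k\in\mathbb{Z}}$ of jumps of $\tilde\psi_0$ and a sequence $(V_j)_{j\in\mathbb{Z}}$ of real constants such that for every finite nonempty $A\subset\mathbb{Z}$ there is a unique $j\in A$ with $\max_{m\in A}V_m=V_j$; and that no $a_k$ with $k\ne0$ is an endpoint of $K_1$. Then, as $n\to\infty$, $\operatorname{sargmax}_{x\in K}\{\psi_n(x)\}\to\operatorname{sargmax}_{x\in K}\{\psi_0(x)\}$ and $\operatorname{largmax}_{x\in K}\{\psi_n(x)\}\to\operatorname{largmax}_{x\in K}\{\psi_0(x)\}$.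
   Context: Coordinates of vectors are written with upper indices. $K=[a^1,b^1]\times\dots\times[a^d,b^d]$ with $a^k<b^k$, $K_1=[a^1,b^1]$, $K_2=[a^2,b^2]\times\dots\times[a^d,b^d]$ (when $d=1$, $K_2$ is a one-point set, so functions on $K_2$ are constants). Space $\mathcal{D}_K^0$: all functions $\psi:K_1\times K_2\to\mathbb{R}$ that can be written, for $(t,\xi)\in K_1\times K_2$, as $$\text{(J)}\quad \psi(t,\xi)=V_0(\xi)\mathbf{1}_{a_{-1}\le t<a_1}+\sum_{k=1}^\infty V_k(\xi)\mathbf{1}_{a_k\le t<a_{k+1}}+\sum_{k=1}^\infty V_{-k}(\xi)\mathbf{1}_{a_{-k-1}\le t<a_{-k}},$$ where $(\dots<a_{-k-1}<a_{-k}<\dots<a_0=0<\dots<a_k<a_{k+1}<\dots)$ is a strictly increasing real sequence with $a_k\to\infty$, $a_{-k}\to-\infty$ as $k\to\infty$ (the ''jumps''; $a_0=0$ is only a placeholder and not a jump), and $V_k:K_2\to\mathbb{R}$, $k\in\mathbb{Z}$, are continuous. Space $\mathcal{S}$: all piecewise constant càdlàg $\tilde\psi:\mathbb{R}\to\mathbb{R}$ with $\tilde\psi(0)=0$, all jumps of size 1 (in absolute value), and $t\mapsto\tilde\psi(t)$, $t\mapsto\tilde\psi(-t)$ nondecreasing on $(0,\infty)$; for a closed interval $I$, $\mathcal{S}_I=\{f|_I: f\in\mathcal{S}\}$. Compatibility: $\psi\in\mathcal{D}^0_K$ can be written in the form (J) for the sequence of jumps of $\tilde\psi\in\mathcal{S}_{K_1}$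 if there is a strictly increasing real sequence $(a_k)_{k\in\mathbb{Z}}$ with $a_0=0$ and $a_k\to\infty$, $a_{-k}\to-\infty$ as $k\to\infty$, and continuous $V_k:K_2\to\mathbb{R}$, $k\in\mathbb{Z}$, such that (J) holds on $K$ and $\tilde\psi(t)=\sum_{k\ge1}\mathbf{1}_{a_k\le t}+\sum_{k\ge1}\mathbf{1}_{a_{-k}>t}$ for all $t\in K_1$. Skorohod metric: for a compact interval $I$ let $\Lambda_I$ be the set of strictly increasing surjections $\lambda:I\to I$ and $|||\lambda|||_I=\sup_{s\ne t}\left|\log\frac{\lambda(t)-\lambda(s)}{t-s}\right|\in[0,\infty]$. For $\lambda=(\lambda_1,\dots,\lambda_d)\in\Lambda_K:=\prod_k\Lambda_{[a^k,b^k]}$ put $|||\lambda|||_K=\max_k|||\lambda_k|||_{[a^k,b^k]}$ and let $\lambda$ act on $K$ coordinatewise. For bounded $f,g:K\to\mathbb{R}$, $d_K(f,g)=\inf_{\lambda\in\Lambda_K}\{|||\lambda|||_K+\sup_{x\in K}|f(x)-g(\lambda(x))|\}$. $d_{K_1}$ is the same metric for the one-dimensional rectangle $K_1$. Maximizers: for $\rho\in\prod_k\{a^k,b^k\}$ and $x\in K$ let $Q(\rho,x)=\prod_k I_k$ with $I_k=[a^k,x^k)$ if $\rho^k=a^k$ and $I_k=(x^k,b^k]$ if $\rho^k=b^k$. If $Q(\rho,x)\ne\emptyset$, the $\rho$-limit $f(x+0_\rho)$ is the common limit of $f(x_n)$ over all sequences $(x_n)\subset Q(\rho,x)$ with $x_n\to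 x$. A point $x\in K$ is a maximizer of $f\in\mathcal{D}_K^0$ if $f(x)$ or one of the limits $f(x+0_\rho)$ equals $\sup_{K}f$. $\operatorname{sargmax}_{x\in K}\{f(x)\}$ is the unique maximizer $x$ such that every maximizer $\xi$ has $x^1\le\xi^1$, and, for each $k\in\{1,\dots,d-1\}$, every maximizer $\xi$ with $\xi^j=x^j$ for $j=1,\dots,k$ has $x^{k+1}\le\xi^{k+1}$ (the lexicographically smallest maximizer). $\operatorname{largmax}$ is defined with the inequalities reversed (the lexicographically largest maximizer). *)

(* Defs.v *)
From HB Require Import structures.
From mathcomp Require Import all_boot all_order all_algebra.
From mathcomp Require Import all_classical all_reals all_analysis.

Set Implicit Arguments.
Unset Strict Implicit.
Unset Printing Implicit Defensive.

Import Order.TTheory GRing.Theory Num.Theory.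
Import numFieldNormedType.Exports.

Local Open Scope classical_set_scope.
Local Open Scope ring_scope.

Section Definitions.
Variable R : realType.

(* Points of R^n are row vectors. A function on a subset of R^n is a total
   function of which only the values on that subset are used. *)
Definition rect n (lo hi : 'rV[R]_n) : set 'rV[R]_n :=
  [set x | forall k, lo 0 k <= x 0 k <= hi 0 k].

(* R^(p+1) = R x R^p: the point x is (x 0 0, vtail x). *)
Definition vtail p (x : 'rV[R]_p.+1) : 'rV[R]_p := \row_k x 0 (lift ord0 k).

Definition rect1 p (lo hi : 'rV[R]_p.+1) : set R :=
  [set t | lo 0 0 <= t <= hi 0 0].

Definition rect2 p (lo hi : 'rV[R]_p.+1) : set 'rV[R]_p :=
  rect (vtail lo) (vtail hi).

Definition ind (b : bool) : R := b%:R.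

Definition jump_seq (a : int -> R) : Prop :=
  [/\ {homo a : i j / i < j},
      a 0 = 0,
      a k%:Z @[k --> \oo] --> +oo &
      a (- k%:Z) @[k --> \oo] --> -oo].

(* For a jump sequence at most one term of the two series is nonzero. *)
Definition jump_expansion p (a : int -> R) (V : int -> 'rV[R]_p -> R)
    (t : R) (xi : 'rV[R]_p) : R :=
  V 0 xi * ind (a (- 1) <= t < a 1)
  + \big[+%R/0]_(1 <= k <oo)
      (V k%:Z xi * ind (a k%:Z <= t < a (k%:Z + 1)))
  + \big[+%R/0]_(1 <= k <oo)
      (V (- k%:Z) xi * ind (a (- k%:Z - 1) <= t < a (- k%:Z))).

Definition form_J p (lo hi : 'rV[R]_p.+1) (psi : 'rV[R]_p.+1 -> R)
    (a : int -> R) (V : int -> 'rV[R]_p -> R) : Prop :=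
  [/\ jump_seq a,
      forall k, {within rect2 lo hi, continuous (V k)} &
      forall x, rect lo hi x -> psi x = jump_expansion a V (x 0 0) (vtail x)].

Definition DK0 p (lo hi : 'rV[R]_p.+1) (psi : 'rV[R]_p.+1 -> R) : Prop :=
  exists a V, form_J lo hi psi a V.

(* D is a locally finite set of breakpoints. *)
Definition piecewise_constant (f : R -> R) : Prop :=
  exists D : set R,
    (forall u v : R, finite_set (D `&` `[u, v])) /\
    (forall x y : R, x <= y -> D `&` `[x, y] = set0 -> f x = f y).

Definition cadlag (f : R -> R) : Prop :=
  forall x : R, f @ x^'+ --> f x /\ cvg (f @ x^'-).

Definition jump (f : R -> R) (x : R) : R := f x - lim (f @ x^'-).

Definition Sspace (f : R -> R) : Prop :=
  [/\ piecewise_constant f /\ cadlag f,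
      f 0 = 0,
      forall x, jump f x != 0 -> `|jump f x| = 1,
      {in `]0, +oo[ &, {homo f : x y / x <= y}} &
      {in `]0, +oo[ &, {homo (fun t => f (- t)) : x y / x <= y}}].

Definition Sspace_on (I : set R) (g : R -> R) : Prop :=
  exists2 f, Sspace f & forall t, I t -> g t = f t.

Definition counts_jumps (I : set R) (tpsi : R -> R) (a : int -> R) : Prop :=
  forall t, I t ->
    tpsi t = \big[+%R/0]_(1 <= k <oo) ind (a k%:Z <= t)
             + \big[+%R/0]_(1 <= k <oo) ind (t < a (- k%:Z)).

Definition form_J_for p (lo hi : 'rV[R]_p.+1) (psi : 'rV[R]_p.+1 -> R)
    (tpsi : R -> R) (a : int -> R) (V : int -> 'rV[R]_p -> R) : Prop :=
  form_J lo hi psi a V /\ counts_jumps (rect1 lo hi) tpsi a.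

Definition compatible p (lo hi : 'rV[R]_p.+1) (psi : 'rV[R]_p.+1 -> R)
    (tpsi : R -> R) : Prop :=
  exists a V, form_J_for lo hi psi tpsi a V.

Definition time_change (u v : R) (l : R -> R) : Prop :=
  {in `[u, v] &, {homo l : s t / s < t}} /\ l @` [set` `[u, v]] = [set` `[u, v]].

Definition time_change_norm (u v : R) (l : R -> R) : \bar R :=
  ereal_sup [set `|ln ((l st.2 - l st.1) / (st.2 - st.1))|%:E
            | st in [set st : R * R |
                [/\ st.1 \in `[u, v], st.2 \in `[u, v] & st.1 != st.2]]].

Definition time_changes n (lo hi : 'rV[R]_n) : set ('I_n -> R -> R) :=
  [set l | forall k, time_change (lo 0 k) (hi 0 k) (l k)].

Definition time_changes_norm n (lo hi : 'rV[R]_n) (l : 'I_n -> R -> R) : \bar R :=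
  \big[maxe/-oo%E]_(k < n) time_change_norm (lo 0 k) (hi 0 k) (l k).

Definition time_changes_act n (l : 'I_n -> R -> R) (x : 'rV[R]_n) : 'rV[R]_n :=
  \row_k l k (x 0 k).

Definition dK n (lo hi : 'rV[R]_n) (f g : 'rV[R]_n -> R) : \bar R :=
  ereal_inf [set (time_changes_norm lo hi l
                  + ereal_sup [set `|f x - g (time_changes_act l x)|%:E
                              | x in rect lo hi])%E
            | l in time_changes lo hi].

Definition dK1 (u v : R) (f g : R -> R) : \bar R :=
  @dK 1 (const_mx u) (const_mx v) (fun x => f (x 0 0)) (fun x => g (x 0 0)).

Definition vertex n (lo hi rho : 'rV[R]_n) : Prop :=
  forall k, rho 0 k = lo 0 k \/ rho 0 k = hi 0 k.

Definition quadrant n (lo hi rho x : 'rV[R]_n) : set 'rV[R]_n :=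
  [set y | forall k,
     (rho 0 k = lo 0 k -> lo 0 k <= y 0 k < x 0 k) /\
     (rho 0 k = hi 0 k -> x 0 k < y 0 k <= hi 0 k)].

Definition is_rho_limit n (lo hi : 'rV[R]_n) (f : 'rV[R]_n -> R)
    (rho x : 'rV[R]_n) (l : R) : Prop :=
  quadrant lo hi rho x !=set0 /\
  forall u : nat -> 'rV[R]_n, (forall m, quadrant lo hi rho x (u m)) ->
    u m @[m --> \oo] --> x -> f (u m) @[m --> \oo] --> l.

Definition maximizer n (lo hi : 'rV[R]_n) (f : 'rV[R]_n -> R)
    (x : 'rV[R]_n) : Prop :=
  rect lo hi x /\
  (f x = sup (f @` rect lo hi) \/
   exists2 rho, vertex lo hi rho &
     is_rho_limit lo hi f rho x (sup (f @` rect lo hi))).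

(* Coordinates are numbered from 0; for k = 0 the condition on the previous
   coordinates is void. *)
Definition is_sargmax n (lo hi : 'rV[R]_n) (f : 'rV[R]_n -> R)
    (x : 'rV[R]_n) : Prop :=
  maximizer lo hi f x /\
  forall (k : 'I_n) (xi : 'rV[R]_n), maximizer lo hi f xi ->
    (forall j : 'I_n, (j < k)%N -> xi 0 j = x 0 j) -> x 0 k <= xi 0 k.

Definition is_largmax n (lo hi : 'rV[R]_n) (f : 'rV[R]_n -> R)
    (x : 'rV[R]_n) : Prop :=
  maximizer lo hi f x /\
  forall (k : 'I_n) (xi : 'rV[R]_n), maximizer lo hi f xi ->
    (forall j : 'I_n, (j < k)%N -> xi 0 j = x 0 j) -> xi 0 k <= x 0 k.

(* For f in D_K^0 on a nondegenerate rectangle the maximizers form a nonempty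
   compact set, so these are attained and xget never returns its default. *)
Definition sargmax n (lo hi : 'rV[R]_n) (f : 'rV[R]_n -> R) : 'rV[R]_n :=
  xget 0 [set x | is_sargmax lo hi f x].

Definition largmax n (lo hi : 'rV[R]_n) (f : 'rV[R]_n -> R) : 'rV[R]_n :=
  xget 0 [set x | is_largmax lo hi f x].

Definition unique_maximizer n (E : set 'rV[R]_n) (g : 'rV[R]_n -> R) : Prop :=
  exists! xi, E xi /\ g xi = sup (g @` E).

(* The maximum over the finite nonempty set A is the supremum of the image. *)
Definition unique_max_index (M : int -> R) : Prop :=
  forall A : set int, finite_set A -> A !=set0 ->
    exists! j, A j /\ sup (M @` A) = M j.

Definition no_jump_at_endpoints p (lo hi : 'rV[R]_p.+1) (a : int -> R) : Prop :=
  forall k : int, k != 0 -> a k != lo 0 0 /\ a k != hi 0 0.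

End Definitions.

(* Main.v *)
(* Idea: write each psi as psi x = V_(pidx (x 0 0)) (vtail x), where pidx t is
   the index of the piece of (J) containing t; then tpsi t = |pidx t|.
   Since the tpsi_n are integer valued, tpsi_n = tpsi_0 \o tlam for a time change
   tlam once their distance is below 1, so the pieces of psi_n are those of
   pidx_0 \o tlam.  If psi_n is close to psi_0 \o lam, the pieces of psi_n
   refine those of pidx_0 \o lam, because the numbers sup V_j are pairwise
   distinct; both partitions having the same number of pieces, they coincide.
   Hence psi_n is constant in its first variable on the preimage under lam of
   the best piece [l0, r0[ of psi_0, and its maximizers are exactly
   [lam^-1 l0, lam^-1 r0] times the maximizers over K_2 of a function close to
   V_j.  The uniqueness of the maximizer of V_j gives the convergence of the
   remaining coordinates. *)
Require Import Defs.
From HB Require Import structures.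
From mathcomp Require Import all_boot all_order all_algebra.
From mathcomp Require Import all_classical all_reals all_analysis.
From mathcomp Require Import zify ring lra.

Import Order.TTheory GRing.Theory Num.Theory.
Import numFieldNormedType.Exports.

Local Open Scope classical_set_scope.
Local Open Scope ring_scope.

(** * Jump sequences and the pieces they cut out of the line *)

Section JumpSequences.
Context {R : realType}.
Implicit Types (a : int -> R) (s t : R) (i j : int).

(* Skips the placeholder a 0, so that the pieces of (J) are the intervals
   [brk a j, brk a (j + 1)[, the j-th one carrying V_j. *)
Definition brk a j : R := if 0 < j then a j else a (j - 1).

(** For a jump sequence exactly one index qualifies, so 0 is never returned as a mere default. *)
Definition pidx a t : int := xget 0 [set j | brk a j <= t < brk a (j + 1)].

Lemma brk_lt a : jump_seq a -> {homo brk a : i j / i < j}.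
Proof.
case=> ha _ _ _ i j ij; rewrite /brk.
by case: ifP; case: ifP => hj hi; apply: ha; lia.
Qed.

Lemma brk_le a i j : jump_seq a -> (brk a i <= brk a j) = (i <= j).
Proof. by move=> /brk_lt ha; exact: (le_mono ha). Qed.

Lemma exists_piece a t : jump_seq a -> exists j, brk a j <= t < brk a (j + 1).
Proof.
move=> ja; have [_ _ /cvgryPgt/(_ t) [N _ hN] /cvgrNyPle/(_ t) [M _ hM]] := ja.
have {}hM : brk a (- M%:Z) <= t.
  rewrite /brk ifF; last by lia.
  have -> : - M%:Z - 1 = - (M.+1)%:Z by lia.
  by apply: hM => /=.
have exn : exists n : nat, t < brk a (- M%:Z + n%:Z).
  exists (M + N.+1)%N; have -> : - M%:Z + (M + N.+1)%N%:Z = N.+1%:Z by lia.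
  by rewrite /brk /=; apply: hN => /=.
(* Counting upward from [- M], whose breakpoint is at most [t], the first breakpoint beyond [t]
   closes the piece that contains [t]. *)
case: (ex_minnP exn) => -[|n] hn minn.
  by move: hn; rewrite addr0 => /lt_le_trans/(_ hM); rewrite ltxx.
exists (- M%:Z + n%:Z); apply/andP; split; last by rewrite -addrA -PoszD addn1.
by rewrite leNgt; apply/negP => /minn; rewrite ltnn.
Qed.

(** [brk a] and [pidx a] form a Galois connection, which turns questions about pieces into integer
    inequalities. *)
Lemma le_pidx a j t : jump_seq a -> (j <= pidx a t) = (brk a j <= t).
Proof.
move=> ja; have /andP[h1 h2] : brk a (pidx a t) <= t < brk a (pidx a t + 1).
  have [k hk] := exists_piece a t ja.
  by rewrite /pidx; case: xgetP => // /(_ k).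
apply/idP/idP => [|hj].
  by rewrite -(brk_le a _ _ ja) => /le_trans; apply.
have := le_lt_trans hj h2; rewrite (leW_mono (fun i j => brk_le a i j ja)); lia.
Qed.

Lemma pidx_lt a j t : jump_seq a -> (pidx a t < j) = (t < brk a j).
Proof. by move=> ja; rewrite !ltNge le_pidx. Qed.

Lemma pidx_eq a j t : jump_seq a ->
  (j == pidx a t) = (brk a j <= t < brk a (j + 1)).
Proof. by move=> ja; rewrite -le_pidx // -pidx_lt //; lia. Qed.

Lemma pidx_le a s t : jump_seq a -> s <= t -> pidx a s <= pidx a t.
Proof. by move=> ja st; rewrite le_pidx // (le_trans _ st) // -le_pidx. Qed.

Lemma pidx_ivt a s t j : jump_seq a -> s <= t -> pidx a s <= j <= pidx a t ->
  exists2 u, s <= u <= t & pidx a u = j.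
Proof.
(* The witness is the first point at or after [s] that does not lie before piece [j]. *)
move=> ja st /andP[sj jt]; exists (Num.max s (brk a j)).
  by rewrite le_max lexx ge_max st -le_pidx.
apply/eqP; rewrite eq_sym pidx_eq // le_max lexx orbT gt_max -pidx_lt //.
by rewrite (brk_lt a ja) ?andbT; lia.
Qed.

Lemma nneg_series_eq (u : nat -> R) (n : nat) : (0 < n)%N ->
  (forall k, (n <= k)%N -> u k = 0) ->
  \big[+%R/0]_(1 <= k <oo) u k = \sum_(1 <= k < n) u k.
Proof.
move=> n0 u0; apply: lim_near_cst => //; near=> m.
have nm : (n <= m)%N by near: m; exact: nbhs_infty_ge.
rewrite (big_cat_nat n0 nm) /= [X in _ + X]big1_seq ?addr0 // => k.
by rewrite mem_index_iota => /andP[_ /andP[/u0]].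
Unshelve. all: by end_near. Qed.

(** The series starts at [k = 1], so [n = 0] encodes that no indicator is on. *)
Lemma series_single (u : nat -> R) (n : nat) :
  \big[+%R/0]_(1 <= k <oo) (u k * ind R (k == n)) =
  if (0 < n)%N then u n else 0.
Proof.
rewrite (nneg_series_eq _ n.+1) //; last first.
  by move=> k nk; rewrite /ind gtn_eqF // mulr0.
case: ifP => n0; last first.
  by rewrite big_geq //; lia.
rewrite big_nat_recr //= /ind eqxx mulr1 big1_seq ?add0r // => k.
by rewrite mem_index_iota => /andP[_ /andP[_ kn]]; rewrite ltn_eqF ?mulr0.
Qed.

Lemma series_count (n : nat) :
  \big[+%R/0]_(1 <= k <oo) ind R (k <= n)%N = n%:R.
Proof.
rewrite (nneg_series_eq _ n.+1) //; last by move=> k nk; rewrite leqNgt nk.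
rewrite (eq_big_nat _ _ (F2 := fun=> 1)); last first.
  by move=> k /andP[_]; rewrite ltnS => ->.
by rewrite big_const_nat subn1 /= iter_addr_0.
Qed.

(** Exactly one indicator of (J) is on at [t]. The sign of [pidx a t] selects its summand; a series
    of the wrong sign is evaluated by [series_single] at index 0. *)
Lemma jump_expansionE p a (V : int -> 'rV[R]_p -> R) t xi : jump_seq a ->
  jump_expansion a V t xi = V (pidx a t) xi.
Proof.
move=> ja; rewrite /jump_expansion.
have -> : (a (- 1) <= t < a 1) = (0 == pidx a t).
  by rewrite pidx_eq // /brk /= add0r.
set S1 := limn _; set S2 := limn _.
have -> : S1 = if 0 < pidx a t then V (pidx a t) xi else 0.
  rewrite (_ : S1 = \big[+%R/0]_(1 <= k <oo)
      (V k%:Z xi * ind R (k == if 0 < pidx a t then `|pidx a t|%N else 0%N)));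
    last first.
    congr (limn _); apply/funext => n; apply: eq_big_nat => k /andP[k1 _].
    congr (_ * ind R _).
    have -> : (a k%:Z <= t < a (k%:Z + 1)) = (k%:Z == pidx a t).
      by rewrite pidx_eq // /brk !ifT //; lia.
    by case: ifP; lia.
  rewrite series_single; case: (ltP 0 (pidx a t)) => h //=.
  by rewrite ifT; [congr (V _ xi); lia | lia].
have -> : S2 = if pidx a t < 0 then V (pidx a t) xi else 0.
  rewrite (_ : S2 = \big[+%R/0]_(1 <= k <oo)
      (V (- k%:Z) xi * ind R (k == if pidx a t < 0 then `|pidx a t|%N else 0%N)));
    last first.
    congr (limn _); apply/funext => n; apply: eq_big_nat => k /andP[k1 _].
    congr (_ * ind R _).
    have -> : (a (- k%:Z - 1) <= t < a (- k%:Z)) = (- k%:Z == pidx a t).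
      rewrite pidx_eq // /brk !ifF; [|lia|lia].
      by rewrite addrK.
    by case: ifP; lia.
  rewrite series_single; case: (ltP (pidx a t) 0) => h //=.
  by rewrite ifT; [congr (V _ xi); lia | lia].
rewrite /ind; case: (ltrgtP 0 (pidx a t)) => [h|h|<-].
- by rewrite mulr0 add0r addr0.
- by rewrite mulr0 !add0r.
- by rewrite mulr1 !addr0.
Qed.

(** The first series counts up to a positive index, the second up to the opposite of a negative one.
    Thus [tpsi] remembers the index only up to sign. *)
Lemma counts_jumpsE (I : set R) tpsi a t : jump_seq a ->
  counts_jumps I tpsi a -> I t -> tpsi t = `|pidx a t|%N%:R.
Proof.
move=> ja /(_ t) /[apply] ->; set S1 := limn _; set S2 := limn _.
have -> : S1 = (if 0 < pidx a t then `|pidx a t|%N else 0%N)%:R.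
  rewrite -series_count; congr (limn _); apply/funext => n.
  apply: eq_big_nat => k /andP[k1 _]; congr (ind R _).
  have -> : (a k%:Z <= t) = (k%:Z <= pidx a t).
    by rewrite le_pidx // /brk ifT //; lia.
  by case: ifP; lia.
have -> : S2 = (if pidx a t < 0 then `|pidx a t|%N else 0%N)%:R.
  rewrite -series_count; congr (limn _); apply/funext => n.
  apply: eq_big_nat => k /andP[k1 _]; congr (ind R _).
  have -> : (t < a (- k%:Z)) = (pidx a t < - k%:Z + 1).
    rewrite pidx_lt // /brk ifF; [|lia]; by rewrite addrK.
  by case: ifP; lia.
rewrite -natrD; congr (_%:R); do 2 case: ifP; lia.
Qed.

End JumpSequences.

(** * Monotone integer-valued functions that skip no value *)

Section StepFunctions.
Context {R : realType}.
Variables (u v : R).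
Implicit Types (q f g : R -> int) (s t w : R).

Definition step_function q :=
  {in `[u, v] &, {homo q : s t / s <= t}} /\
  {in `[u, v] &, forall s t j, s <= t -> q s <= j <= q t ->
    exists2 w, s <= w <= t & q w = j}.

Lemma in_sub_itv s t w : s \in `[u, v] -> t \in `[u, v] ->
  s <= w <= t -> w \in `[u, v].
Proof. by rewrite !in_itv /=; lra. Qed.

(** Where [q1] is constant, the absolute value of [q2] is fixed, so [q2] could only pass from [- c]
    to [c] with [c > 0]. It would then take the value 0 on the way, which has the wrong absolute
    value. *)
Lemma step_function_absz q1 q2 : step_function q1 -> step_function q2 ->
  {in `[u, v], forall t, `|q1 t|%N = `|q2 t|%N} ->
  {in `[u, v] &, forall s t, q1 s = q1 t -> q2 s = q2 t}.
Proof.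
move=> [m1 _] [m2 i2] e12 s t; wlog st : s t / s <= t.
  move=> W sI tI e; have [/W|/ltW/W] := leP s t; first exact.
  by move=> <-.
move=> sI tI e; have cst w : s <= w <= t -> `|q2 w|%N = `|q2 s|%N.
  move=> swt; have wI := in_sub_itv _ _ _ sI tI swt.
  rewrite -!e12 //; congr `|_|%N; apply/eqP; rewrite eq_le.
  by have /andP[sw wt] := swt; rewrite {1}e !m1.
have q2st := m2 _ _ sI tI st; have := cst t; rewrite st lexx => /(_ isT) ct.
apply/eqP; apply/negPn/negP => ne; have [] := i2 _ _ sI tI 0 st; first lia.
by move=> w /cst + w0; rewrite w0; lia.
Qed.

(* A step of f that is not also a step of g would leave the total increment of
   g short of that of f. *)
Lemma step_function_eq f g : u <= v -> step_function f -> step_function g ->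
  {in `[u, v] &, forall s t, f s = f t -> g s = g t} ->
  f u = g u -> f v = g v -> {in `[u, v], f =1 g}.
Proof.
move=> uv [mf jf] [mg jg] fg fgu fgv.
(* Induction on the increment of [f], peeling off its last unit step. *)
have inc (n : nat) s t : s \in `[u, v] -> t \in `[u, v] -> s <= t ->
    f t - f s = n%:Z -> g t - g s <= n%:Z.
  elim: n t => [|n IH] t sI tI st e.
    by rewrite (fg s t) ?subrr //; lia.
  have [|w swt fw] := jf _ _ sI tI (f t - 1) st; first lia.
  have wI := in_sub_itv _ _ _ sI tI swt; have /andP[sw wt] := swt.
  have gws : g w - g s <= n%:Z by apply: IH => //; lia.
  suff : g t - g w <= 1 by move: gws; clear; lia.
  (* If [g] rose by two or more from [w] to [t], it would equal [g w + 1] at some [z]. But [f z] is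
     [f w] or [f t], so [g z] is [g w] or [g t]. *)
  rewrite leNgt; apply/negP => gwt.
  have [|z wzt gz] := jg _ _ wI tI (g w + 1) wt; first by move: gwt; clear; lia.
  have zI := in_sub_itv _ _ _ wI tI wzt; have /andP[wz zt] := wzt.
  have fwz := mf _ _ wI zI wz; have fzt := mf _ _ zI tI zt.
  have [e1|e1] : f z = f w \/ f z = f t by move: fw fwz fzt; clear; lia.
    by move: gz; rewrite (fg _ _ zI wI e1); clear; lia.
  by move: gwt gz; rewrite (fg _ _ zI tI e1); clear; lia.
move=> t tI; have uI : u \in `[u, v] by rewrite in_itv /= lexx.
have vI : v \in `[u, v] by rewrite in_itv /= lexx uv.
move: (tI); rewrite in_itv /= => /andP[ut tv].
have fut := mf _ _ uI tI ut; have ftv := mf _ _ tI vI tv.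
(* On both sides of [t] the increment of [g] is at most that of [f]; the total increments agree, so
   both bounds are equalities. *)
have le1 : g t - g u <= f t - f u.
  by rewrite -(gez0_abs (m := f t - f u)) ?inc ?gez0_abs ?subr_ge0.
have le2 : g v - g t <= f v - f t.
  by rewrite -(gez0_abs (m := f v - f t)) ?inc ?gez0_abs ?subr_ge0.
by move: le1 le2 fgu fgv; clear; lia.
Qed.

End StepFunctions.

(** * Time changes of an interval *)

Section TimeChange.
Context {R : realType}.
Context {u v : R} {l : R -> R} (lP : time_change u v l).
Implicit Types s t : R.

Lemma time_change_le : {in `[u, v] &, {mono l : s t / s <= t}}.
Proof. by case: lP => /le_mono_in. Qed.

Lemma time_change_lt : {in `[u, v] &, {mono l : s t / s < t}}.
Proof. exact: leW_mono_in time_change_le. Qed.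

Lemma time_change_in t : t \in `[u, v] -> l t \in `[u, v].
Proof.
case: lP => _ im tI; have : (l @` [set` `[u, v]]) (l t) by exists t.
by rewrite im.
Qed.

Lemma time_change_onto t : t \in `[u, v] -> exists2 s, s \in `[u, v] & l s = t.
Proof.
by case: lP => _ im tI; have : [set` `[u, v]] t := tI; rewrite -im => -[s]; exists s.
Qed.

Lemma time_change_left : u <= v -> l u = u.
Proof.
move=> uv; have uI : u \in `[u, v] by rewrite in_itv /= lexx.
have [s sI su] := time_change_onto _ uI.
apply/eqP; rewrite eq_le -{2}su time_change_le //.
move: (sI) (time_change_in _ uI); rewrite !in_itv /= => /andP[-> _] /andP[-> _].
by rewrite andbT.
Qed.

Lemma time_change_right : u <= v -> l v = v.
Proof.
move=> uv; have vI : v \in `[u, v] by rewrite in_itv /= lexx uv.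
have [s sI sv] := time_change_onto _ vI.
apply/eqP; rewrite eq_le -{3}sv time_change_le //.
move: (sI) (time_change_in _ vI); rewrite !in_itv /= => /andP[_ ->] /andP[_ ->].
by [].
Qed.

Lemma step_function_pidx (a : int -> R) : jump_seq a ->
  step_function u v (fun t => pidx a (l t)).
Proof.
move=> ja; split=> [s t sI tI st|s t sI tI j st].
  by apply: pidx_le => //; rewrite time_change_le.
move=> /pidx_ivt [||w swt wj] //; first by rewrite time_change_le.
have [z zI zw] : exists2 z, z \in `[u, v] & l z = w.
  apply: time_change_onto; apply: in_sub_itv swt; exact: time_change_in.
by exists z; [move: swt; rewrite -zw !time_change_le | rewrite zw].
Qed.

End TimeChange.

Lemma time_change_id {R : realType} (u v : R) : time_change u v id.
Proof. by split=> //; rewrite image_id. Qed.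

(** * What a small Skorohod distance provides *)

Section SkorohodMetric.
Context {R : realType}.

Lemma time_change_norm_ge0 (u v : R) l : u < v -> (0 <= time_change_norm u v l)%E.
Proof.
move=> uv; apply: (@le_trans _ _ `|ln ((l v - l u) / (v - u))|%:E) => //.
apply: ereal_sup_ubound; exists (u, v) => //; split => /=; rewrite ?lt_eqF //;
  by rewrite in_itv /= lexx ltW.
Qed.

(** Since [l] fixes [u], the chord slope [r] from [u] to [t] determines [l t], and the bound on its
    logarithm puts [r] between [expR (- e)] and [expR e]. *)
Lemma time_change_dist (u v : R) l (e t : R) : time_change u v l ->
  (time_change_norm u v l < e%:E)%E -> t \in `[u, v] ->
  `|l t - t| <= (expR e - 1) * (v - u).
Proof.
move=> lP nl tI; have := tI; rewrite in_itv /= => /andP[ut tv].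
have uv := le_trans ut tv.
have uI : u \in `[u, v] by rewrite in_itv /= lexx.
have lu := time_change_left lP uv.
have [e0|e0] := ltP e 0; last first.
  have E1 : 0 <= expR e - 1 by rewrite subr_ge0 -expR0 ler_expR.
  move: ut; rewrite le_eqVlt => /predU1P[<-|ut].
    by rewrite lu subrr normr0 mulr_ge0 // subr_ge0.
  pose r := (l t - l u) / (t - u).
  have r0 : 0 < r by rewrite divr_gt0 // subr_gt0 // (time_change_lt lP).
  have : (`|ln r|%:E < e%:E)%E.
    apply: le_lt_trans nl; apply: ereal_sup_ubound.
    by exists (u, t) => //; split; rewrite //= lt_eqF.
  rewrite lte_fin ltr_norml => /andP[r1 r2].
  have {}r2 : r < expR e by rewrite -[r]lnK ?posrE // ltr_expR.
  have {}r1 : expR (- e) < r by rewrite -[r]lnK ?posrE // ltr_expR.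
  have E2 : expR (- e) * expR e = 1 by rewrite -expRD addNr expR0.
  (* Hence [1 - r] is bounded by [expR e - 1], just as [r - 1] is. *)
  have E3 : 2 - expR e <= expR (- e).
    have := expR_gt0 (- e); have : expR (- e) <= 1 by rewrite -expR0 ler_expR oppr_le0.
    nra.
  have -> : l t - t = (r - 1) * (t - u).
    by rewrite /r lu; field; rewrite subr_eq0 gt_eqF.
  rewrite normrM ler_pM //; first by rewrite ler_norml; lra.
  by rewrite gtr0_norm ?subr_gt0 // lerD2r.
(* For negative [e] the bound on the norm contradicts its nonnegativity unless [u = v]. *)
move: ut; rewrite le_eqVlt => /predU1P[tu|ut]; last first.
  have := lt_trans nl (_ : (e%:E < 0)%E); rewrite lte_fin => /(_ e0).
  by rewrite ltNge time_change_norm_ge0 // (lt_le_trans ut).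
move: uv; rewrite le_eqVlt => /predU1P[<-|uv].
  by rewrite -tu lu !subrr normr0 mulr0.
have := lt_trans nl (_ : (e%:E < 0)%E); rewrite lte_fin => /(_ e0).
by rewrite ltNge time_change_norm_ge0.
Qed.

Context {n : nat} {lo hi : 'rV[R]_n} {l : 'I_n -> R -> R}.
Hypothesis lP : time_changes lo hi l.

Lemma time_changes_act_rect x : rect lo hi x ->
  rect lo hi (time_changes_act l x).
Proof.
move=> xK k; rewrite mxE; have := time_change_in (lP k) (x 0 k).
by rewrite !in_itv /=; apply; exact: xK.
Qed.

Lemma time_changes_act_onto y : rect lo hi y ->
  exists2 x, rect lo hi x & time_changes_act l x = y.
Proof.
move=> yK; have ex k : exists s, s \in `[lo 0 k, hi 0 k] /\ l k s = y 0 k.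
  by have [|s sI sy] := time_change_onto (lP k) (y 0 k); [exact: yK|exists s].
have [f fP] := choice ex; exists (\row_k f k) => [k|].
  by rewrite mxE; have [] := fP k; rewrite in_itv.
by apply/rowP => k; rewrite !mxE; have [] := fP k.
Qed.

End SkorohodMetric.

(** Both summands under the infimum are nonnegative, so a sum below [e] bounds each of them. The
    dimension is positive because an empty maximum of norms would be [-oo]. *)
Lemma dK_lt {R : realType} n (lo hi : 'rV[R]_n.+1) f g (e : R) :
  (forall k, lo 0 k < hi 0 k) -> (dK lo hi f g < e%:E)%E ->
  exists l, [/\ time_changes lo hi l,
    forall k, (time_change_norm (lo 0%R k) (hi 0%R k) (l k) < e%:E)%E &
    forall x, rect lo hi x -> `|f x - g (time_changes_act l x)| < e].
Proof.
move=> lohi /ereal_inf_lt[_ [l lP <-]] lte; exists l.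
have norm_ge k : (time_change_norm (lo 0%R k) (hi 0%R k) (l k) <=
    time_changes_norm lo hi l)%E by exact: le_bigmax.
have norm0 : (0 <= time_changes_norm lo hi l)%E.
  by apply: le_trans (norm_ge ord0); exact: time_change_norm_ge0.
set S := ereal_sup _ in lte.
have S_ge x : rect lo hi x -> (`|f x - g (time_changes_act l x)|%:E <= S)%E.
  by move=> xK; apply: ereal_sup_ubound; exists x.
have S0 : (0 <= S)%E.
  apply: le_trans (S_ge lo _); first by rewrite lee_fin.
  by move=> k; rewrite lexx ltW.
split=> // [k|x xK].
  by apply: le_lt_trans lte; apply: le_trans (norm_ge k) _; rewrite leeDl.
rewrite -lte_fin; apply: le_lt_trans lte; apply: le_trans (S_ge _ xK) _.
by rewrite leeDr.
Qed.

(** * Maximization of continuous functions on compact sets *)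

Section CompactMaximization.
Context {R : realType} {n : nat}.
Implicit Types (E : set 'rV[R]_n) (f : 'rV[R]_n -> R) (x : 'rV[R]_n).

Lemma cvg_rowP {T : Type} {F : set_system T} {FF : Filter F}
    (g : T -> 'rV[R]_n) x :
  g @ F --> x <->
  forall e, 0 < e -> \forall t \near F, forall k, `|g t 0 k - x 0 k| < e.
Proof.
split=> [/cvg_ballP gx e e0|gx].
  near=> t; have [_ xg] : ball x e (g t) by near: t; exact: gx.
  by move=> k; rewrite distrC; exact: xg.
apply/cvg_ballP => e e0; apply: filterS (gx e e0) => t gt; split=> // i k.
by rewrite ord1 -ball_normE /= distrC; exact: gt.
Unshelve. all: by end_near. Qed.

Lemma rect_compact (lo hi : 'rV[R]_n) : compact (rect lo hi).
Proof.
have -> : rect lo hi = [set x | forall k, `[lo 0 k, hi 0 k]%classic (x 0 k)].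
  by apply/seteqP; split=> x xK k; have := xK k; rewrite /= in_itv.
by apply: (@rV_compact R n (fun k => `[lo 0 k, hi 0 k]%classic)) => k; exact: segment_compact.
Qed.

Lemma continuous_coord k : continuous (fun x => x 0 k).
Proof. by move=> x; exact: coord_continuous. Qed.

Lemma within_continuous_seq E f (u : nat -> 'rV[R]_n) x :
  {within E, continuous f} -> (forall m, E (u m)) -> E x ->
  u m @[m --> \oo] --> x -> f (u m) @[m --> \oo] --> f x.
Proof.
move=> /subspace_continuousP cf uE xE ux.
apply: (cvg_comp u f) (cf x xE) => A; rewrite withinE => -[B xB AB].
have uB : \forall m \near \oo, B (u m) := ux B xB.
apply: filterS uB => m Bm /=.
by have : (B `&` E) (u m) by []; rewrite -AB => -[].
Qed.

(** Continuity holds only within [E], so the level set is closed in the subspace, that is, the trace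
    on [E] of a closed set [B]. *)
Lemma compact_level_set E f c : compact E -> {within E, continuous f} ->
  compact [set x | E x /\ f x = c].
Proof.
move=> cE cf; have /closed_subspaceP[B cB BE] : closed
    ((f : subspace E -> R) @^-1` [set c] : set (subspace E)).
  by have /continuous_closedP := cf; apply; exact: closed_eq.
rewrite (_ : [set _ | _] = E `&` B); first exact: compact_closedI.
rewrite setIC BE; apply/seteqP; split=> x; first by case.
by case.
Qed.

Lemma compact_sup_attained E f : E !=set0 -> compact E ->
  {within E, continuous f} ->
  (exists2 x, E x & f x = sup (f @` E)) /\
  (forall x, E x -> f x <= sup (f @` E)).
Proof.
move=> E0 cE cf; have [c /set_mem Ec cmax] := EVT_max_rV E0 cE cf.
have ub : ubound (f @` E) (f c) by move=> _ [x Ex <-]; apply: cmax; exact/mem_set.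
have le x : E x -> f x <= sup (f @` E).
  by move=> Ex; apply: ub_le_sup; [exists (f c) | exists x].
split=> //; exists c => //; apply/eqP; rewrite eq_le le //= ge_sup //.
by exists (f c), c.
Qed.

(** On the compact part of [E] that is at least [e] away from [z] in coordinate [k], the maximum of
    [f] stays strictly below the supremum; any [d] up to this gap works. *)
Lemma near_unique_maximizer E f z e : compact E -> {within E, continuous f} ->
  E z -> f z = sup (f @` E) -> (forall x, E x -> f x = sup (f @` E) -> x = z) ->
  0 < e ->
  \forall d \near 0^'+, forall x, E x -> sup (f @` E) - d < f x ->
    forall k, `|x 0 k - z 0 k| < e.
Proof.
move=> cE cf Ez fz uz e0.
have [_ lesup] := compact_sup_attained _ _ (ex_intro _ z Ez) cE cf.
suff H k : \forall d \near 0^'+, forall x, E x -> sup (f @` E) - d < f x ->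
    `|x 0 k - z 0 k| < e.
  have : \forall d \near 0^'+, forall k x, E x -> sup (f @` E) - d < f x ->
    `|x 0 k - z 0 k| < e by exact: filter_forall.
  by apply: filterS => d Hd x Ex fx k; exact: Hd.
pose E' := E `&` [set x | e <= `|x 0 k - z 0 k|].
have cE' : compact E'.
  apply: compact_closedI => //.
  apply: (@preimage_closed _ _ (fun x => x 0 k) [set r | e <= `|r - z 0 k|]).
    by move=> x _; exact: continuous_coord.
  apply: (@preimage_closed _ _ (fun r : R => `|r - z 0 k|) [set r | e <= r]).
    by move=> r _; apply: cvg_norm; apply: cvgB => //; exact: cvg_cst.
  exact: closed_ge.
have [E'0|E'0] := pselect (E' !=set0); last first.
  near=> d => x Ex _; rewrite ltNge; apply/negP => ex.
  by apply: E'0; exists x.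
have cf' : {within E', continuous f}.
  by apply: continuous_subspaceW cf => x [].
have [c /set_mem[Ec ec] cmax] := EVT_max_rV E'0 cE' cf'.
have fc : f c < sup (f @` E).
  rewrite lt_neqAle lesup // andbT; apply/eqP => /(uz _ Ec) cz.
  by move: ec; rewrite /= cz subrr normr0 leNgt e0.
near=> d => x Ex fx; rewrite ltNge; apply/negP => ex.
have : f x <= f c by apply: cmax; apply/mem_set.
apply/negP; rewrite -ltNge; apply: le_lt_trans fx.
rewrite lerBrDr -lerBrDl; near: d.
by apply: nbhs_right_le; rewrite subr_gt0.
Unshelve. all: by end_near. Qed.

(** Coordinates are optimised one after another, each over the compact set of points agreeing with
    the current one in the earlier coordinates. The signs [s = 1] and [s = -1] give the
    lexicographically smallest and largest points. *)
Lemma lex_extremum (s : R) E : compact E -> E !=set0 ->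
  exists2 x, E x & forall (k : 'I_n) y, E y ->
    (forall j : 'I_n, (j < k)%N -> y 0 j = x 0 j) -> s * x 0 k <= s * y 0 k.
Proof.
move=> cE E0; suff H m : exists2 x, E x & forall (k : 'I_n) y, (k < m)%N -> E y ->
    (forall j : 'I_n, (j < k)%N -> y 0 j = x 0 j) -> s * x 0 k <= s * y 0 k.
  by have [x Ex xP] := H n; exists x => // k y; exact: xP.
elim: m => [|m [x Ex xP]]; first by have [x Ex] := E0; exists x.
have [nm|mn] := leqP n m.
  by exists x => // k y _; apply: xP; apply: leq_trans nm.
pose E' := E `&` \bigcap_(j in [set j : 'I_n | (j < m)%N]) 
  ((fun y : 'rV[R]_n => y 0 j) @^-1` [set x 0 j]).
have cE' : compact E'.
  apply: compact_closedI => //; apply: closed_bigI => j _.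
  apply: preimage_closed.
    by move=> y _; exact: continuous_coord.
  exact: closed_eq.
have cs : {within E', continuous (fun y => s * y 0 (Ordinal mn))}.
  apply: continuous_subspaceT => y.
  apply: (@continuous_comp _ _ _ (fun y : 'rV[R]_n => y 0 (Ordinal mn)) ( *%R s)).
    exact: continuous_coord.
  exact: mulrl_continuous.
have [|z /set_mem[Ez zx] zmin] := EVT_min_rV _ cE' cs; first by exists x.
have {}zx (j : 'I_n) : (j < m)%N -> z 0 j = x 0 j by exact: zx.
exists z => // k y; rewrite ltnS leq_eqVlt => /predU1P[km|km] Ey yz.
  have -> : k = Ordinal mn by exact: val_inj.
  apply: zmin; apply/mem_set; split=> // j jm /=.
  by rewrite yz ?zx // km.
rewrite zx //; apply: xP => // j jk; rewrite yz // zx //; exact: ltn_trans km.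
Qed.

End CompactMaximization.

(** * Splitting off the first coordinate *)

Section ProductRectangle.
Context {R : realType} {p : nat}.
Implicit Types (x lo hi : 'rV[R]_p.+1) (t : R) (xi : 'rV[R]_p).

Definition vcons t xi : 'rV[R]_p.+1 :=
  \row_k (if unlift ord0 k is Some j then xi 0 j else t).

Lemma vcons_head t xi : vcons t xi 0 0 = t.
Proof. by rewrite mxE unlift_none. Qed.

Lemma vtail_vcons t xi : vtail (vcons t xi) = xi.
Proof. by apply/rowP => k; rewrite !mxE liftK. Qed.

Lemma vtailE x k : vtail x 0 k = x 0 (lift ord0 k).
Proof. by rewrite mxE. Qed.

Lemma rectE lo hi x :
  rect lo hi x <-> lo 0 0 <= x 0 0 <= hi 0 0 /\ rect2 lo hi (vtail x).
Proof.
split=> [xK|[x0 xK] k]; first by split=> [|k]; [|rewrite !vtailE]; exact: xK.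
by have [j ->|->] := unliftP ord0 k; [have := xK j; rewrite !vtailE|].
Qed.

Lemma cvg_vtail (u : nat -> 'rV[R]_p.+1) x :
  u m @[m --> \oo] --> x -> vtail (u m) @[m --> \oo] --> vtail x.
Proof.
move=> /cvg_rowP ux; apply/cvg_rowP => e /ux; apply: filterS => m um k.
by rewrite !vtailE.
Qed.

End ProductRectangle.

(** * Approaching a point inside a quadrant *)

Section Quadrants.
Context {R : realType} {n : nat} {lo hi : 'rV[R]_n}.
Hypothesis lohi : forall k, lo 0 k < hi 0 k.

Lemma quadrant_rect rho x y : vertex lo hi rho -> rect lo hi x ->
  quadrant lo hi rho x y -> rect lo hi y.
Proof.
move=> vrho xK qy k; have := xK k; have [] := qy k.
by case: (vrho k) => ->; [move=> /(_ erefl) + _ | move=> _ /(_ erefl)]; lra.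
Qed.

(** The segment from any [y] of the quadrant to [x] stays in the quadrant before its end, and
    [harmonic m] lies in []0, 1]]. Hence a rho-limit is the limit along at least one sequence. *)
Lemma quadrant_approach rho x : quadrant lo hi rho x !=set0 ->
  exists2 u : nat -> 'rV[R]_n,
    forall m, quadrant lo hi rho x (u m) & u m @[m --> \oo] --> x.
Proof.
case=> y qy; exists (fun m => x + harmonic m *: (y - x)) => [m k|]; last first.
  have -> : nbhs x = nbhs (x + 0 *: (y - x)) by rewrite scale0r addr0.
  by apply: cvgD; [exact: cvg_cst | apply: cvgZr_tmp; exact: cvg_harmonic].
have [q1 q2] := qy k; rewrite !mxE.
have h0 : 0 < harmonic m :> R by rewrite invr_gt0 ltr0n.
have h1 : harmonic m <= 1 :> R by rewrite invf_le1 ?ltr0n // ler1n.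
by split=> e; [have := q1 e|have := q2 e]; nra.
Qed.

(** Chooses the lower side wherever there is room. The quadrant is then nonempty at every point of
    the rectangle and approaches the right end of a plateau from the left. *)
Definition inner_vertex (x : 'rV[R]_n) : 'rV[R]_n :=
  \row_k (if lo 0 k < x 0 k then lo 0 k else hi 0 k).

Lemma vertex_inner x : vertex lo hi (inner_vertex x).
Proof. by move=> k; rewrite mxE; case: ifP; [left|right]. Qed.

Lemma quadrant_inner x : rect lo hi x ->
  quadrant lo hi (inner_vertex x) x !=set0.
Proof.
move=> xK; exists (inner_vertex x) => k; rewrite mxE.
have /andP[lx xh] := xK k; have lh := lohi k.
by case: ltP => h; split=> e; apply/andP; split; lra.
Qed.

End Quadrants.

(** * Maximizers of a function whose top values lie on one slab *)

(* D is [l, r[ or [l, r]; only where x 0 0 = r may the supremum be reached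
   through a rho-limit alone. *)
Section Plateau.
Context {R : realType} {p : nat} {lo hi : 'rV[R]_p.+1} {phi : 'rV[R]_p.+1 -> R}.
Context {W : 'rV[R]_p -> R} {D : set R} {l r m : R}.
Hypothesis lohi : forall k, lo 0 k < hi 0 k.
Hypotheses (lol : lo 0 0 <= l) (lr : l < r) (rhi : r <= hi 0 0).
Hypothesis Dsub : forall t, D t -> l <= t <= r.
Hypothesis subD : forall t, l <= t < r -> D t.
Hypothesis Wcont : {within rect2 lo hi, continuous W}.
Hypothesis phiD : forall x, rect lo hi x -> D (x 0 0) -> phi x = W (vtail x).
Hypothesis phiND : forall x, rect lo hi x -> ~ D (x 0 0) -> phi x <= m.
Local Notation M := (sup (W @` rect2 lo hi)).
Hypothesis mM : m < M.

Let rect2_neq0 : rect2 lo hi !=set0.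
Proof. by exists (vtail lo) => k; rewrite !vtailE lexx ltW. Qed.

Let W_sup : (exists2 xi, rect2 lo hi xi & W xi = M) /\
  (forall xi, rect2 lo hi xi -> W xi <= M).
Proof.
exact: (compact_sup_attained _ _ rect2_neq0 (rect_compact _ _) Wcont).
Qed.

Lemma plateau_sup : sup (phi @` rect lo hi) = M.
Proof.
have [[z zK Wz] leM] := W_sup.
have ub : ubound (phi @` rect lo hi) M.
  move=> _ [x xK <-]; have [_ tK] := (rectE _ _ _).1 xK.
  have [Dx|nDx] := pselect (D (x 0 0)); first by rewrite phiD ?leM.
  exact: le_trans (phiND _ xK nDx) (ltW mM).
have lzK : rect lo hi (vcons l z).
  apply/rectE; rewrite vcons_head vtail_vcons; split=> //.
  by rewrite lol (le_trans (ltW lr)).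
have im : (phi @` rect lo hi) M.
  exists (vcons l z) => //; rewrite phiD // ?vtail_vcons // vcons_head.
  by apply: subD; rewrite lexx.
by apply/eqP; rewrite eq_le ge_sup ?ub_le_sup //; exists M.
Qed.

(** Values close to [M] exceed [m] and so occur only over [D], where [phi] is [W] of the tail;
    continuity of [W] then evaluates every rho-limit involved. *)
Lemma maximizer_plateau x : maximizer lo hi phi x <->
  [/\ rect2 lo hi (vtail x), l <= x 0 0 <= r & W (vtail x) = M].
Proof.
rewrite /maximizer plateau_sup; split=> [[xK Mx]|[tK x0 WM]]; last first.
  have xK : rect lo hi x.
    have /andP[lx xr] := x0.
    by apply/rectE; split=> //; rewrite (le_trans lol) // (le_trans xr).
  split=> //; have [Dx|nDx] := pselect (D (x 0 0)); first by left; rewrite phiD.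
  have {x0}xr : x 0 0 = r.
    apply/eqP; rewrite eq_le (andP x0).2 /= leNgt; apply/negP => xr.
    by apply: nDx; apply: subD; rewrite (andP x0).1.
  right; exists (@inner_vertex _ _ lo hi x); first exact: vertex_inner.
  split=> [|u qu ux]; first exact: quadrant_inner.
  have uK k := quadrant_rect _ _ _ (vertex_inner x) xK (qu k).
  (* The quadrant lies to the left of [r], so its points within [r - l] of [x] have first coordinate
     in [[l, r[]. *)
  have uD : \forall k \near \oo, D (u k 0 0).
    have /cvg_rowP/(_ (r - l)) := ux; rewrite subr_gt0 => /(_ lr).
    apply: filterS => k /(_ 0); rewrite xr ltr_norml => /andP[uk _].
    have inner0 : @inner_vertex _ _ lo hi x 0 0 = lo 0 0.
      by rewrite mxE ifT // xr (le_lt_trans lol).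
    have /andP[_ ur] := (qu k 0).1 inner0; apply: subD.
    by move: uk ur; rewrite xr; lra.
  apply: (cvg_trans (near_eq_cvg (f := fun k => W (vtail (u k))) _)).
    by apply: filterS uD => k Dk; rewrite phiD.
  rewrite -WM; apply: within_continuous_seq Wcont _ tK (cvg_vtail _ _ ux).
  by move=> k; have [] := (rectE _ _ _).1 (uK k).
have [_ tK] := (rectE _ _ _).1 xK.
case: Mx => [phix|[rho vrho [q0 qlim]]].
  have Dx : D (x 0 0).
    by apply: contrapT => /(phiND _ xK); rewrite phix leNgt mM.
  by split; [|exact: Dsub|rewrite -phiD].
have [u qu ux] := quadrant_approach _ _ q0.
have uK k := quadrant_rect _ _ _ vrho xK (qu k).
have phiu := qlim u qu ux.
have uD : \forall k \near \oo, D (u k 0 0).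
  have : \forall k \near \oo, m < phi (u k) by exact: (cvgr_gt _ phiu).
  apply: filterS => k mu.
  by apply: contrapT => /(phiND _ (uK k)); rewrite leNgt mu.
split=> //.
  (* Points of the closed interval [[l, r]] accumulate at [x 0 0]. *)
  have near_x e : 0 < e -> exists2 s, l <= s <= r & `|s - x 0 0| < e.
    have /cvg_rowP uP := ux; move=> /uP ue.
    have [k [Dk uk]] := filter_ex (filterI uD ue).
    by exists (u k 0 0); [exact: Dsub|exact: uk].
  apply/andP; split; rewrite leNgt; apply/negP; rewrite -subr_gt0 => /near_x;
    by move=> [s]; rewrite ltr_norml; lra.
have Wu : W (vtail (u k)) @[k --> \oo] --> W (vtail x).
  apply: within_continuous_seq Wcont _ tK (cvg_vtail _ _ ux).
  by move=> k; have [] := (rectE _ _ _).1 (uK k).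
apply: (cvg_unique _ Wu) => //.
apply: (cvg_trans (near_eq_cvg (f := fun k => phi (u k)) _)) phiu.
by apply: filterS uD => k Dk; rewrite phiD.
Qed.

(** The maximizers form the product of [[l, r]] and a level set of [W], so the first coordinate and
    the tail can be optimised separately. *)
Lemma lex_maximizer (s : R) (e : R) : e \in [:: l; r] ->
  (forall t, l <= t <= r -> s * e <= s * t) ->
  exists2 x, maximizer lo hi phi x & forall (k : 'I_p.+1) xi,
    maximizer lo hi phi xi -> (forall j : 'I_p.+1, (j < k)%N -> xi 0 j = x 0 j) ->
    s * x 0 k <= s * xi 0 k.
Proof.
move=> elr emin; have [[z zK Wz] _] := W_sup.
have [|c [cK Wc] cmin] := lex_extremum s _
    (compact_level_set _ _ M (@rect_compact _ _ _ _) Wcont).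
  by exists z.
exists (vcons e c).
  apply/maximizer_plateau; rewrite vcons_head vtail_vcons; split=> //.
  by move: elr; rewrite !inE => /orP[]/eqP->; rewrite lexx ltW.
move=> k xi /maximizer_plateau[tK xi0 Wxi].
have [j ->|-> _] := unliftP ord0 k; last by rewrite vcons_head emin.
move=> agree; rewrite -!vtailE vtail_vcons; apply: cmin => // i ij.
by rewrite vtailE agree ?lift0 //= -vtailE vtail_vcons.
Qed.

Lemma sargmax_plateau : let x := sargmax lo hi phi in
  [/\ rect2 lo hi (vtail x), x 0 0 = l & W (vtail x) = M].
Proof.
have [||x xm xmin] := lex_maximizer 1 l; first by rewrite !inE eqxx.
  by move=> t /andP[lt _]; rewrite !mul1r.
have : is_sargmax lo hi phi (sargmax lo hi phi).
  (* The point [x] just found rules out the default value. *)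
  rewrite /sargmax; case: xgetP => // /(_ x); case; split=> // k xi xim agree.
  by have := xmin k xi xim agree; rewrite !mul1r.
move: (sargmax _ _ _) => y [/maximizer_plateau[tK /andP[ly _] Wy] ymin].
(* Moving the first coordinate of [y] to [l] keeps it a maximizer, so minimality gives
   [y 0 0 <= l]. *)
split=> //; apply/eqP; rewrite eq_le ly andbT -(vcons_head l (vtail y)).
apply: ymin => //; apply/maximizer_plateau.
by rewrite vcons_head vtail_vcons lexx ltW.
Qed.

Lemma largmax_plateau : let x := largmax lo hi phi in
  [/\ rect2 lo hi (vtail x), x 0 0 = r & W (vtail x) = M].
Proof.
have [||x xm xmin] := lex_maximizer (- 1) r; first by rewrite !inE eqxx orbT.
  by move=> t /andP[_ tr]; rewrite !mulN1r lerN2.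
have : is_largmax lo hi phi (largmax lo hi phi).
  rewrite /largmax; case: xgetP => // /(_ x); case; split=> // k xi xim agree.
  by have := xmin k xi xim agree; rewrite !mulN1r lerN2.
move: (largmax _ _ _) => y [/maximizer_plateau[tK /andP[_ yr] Wy] ymin].
split=> //; apply/eqP; rewrite eq_le yr /= -[leLHS](vcons_head r (vtail y)).
apply: ymin => //; apply/maximizer_plateau.
by rewrite vcons_head vtail_vcons lexx ltW.
Qed.

End Plateau.

(** * Comparison of suprema, tails of time changes, finite ranges of indices *)

Lemma sup_le_shift {R : realType} {n : nat} (E : set 'rV[R]_n) f g (c : R) :
  E !=set0 -> compact E -> {within E, continuous f} -> {within E, continuous g} ->
  (forall x, E x -> exists2 y, E y & f x <= g y + c) ->
  sup (f @` E) <= sup (g @` E) + c.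
Proof.
move=> E0 cE cf cg fg; have [[x Ex <-] _] := compact_sup_attained _ _ E0 cE cf.
have [_ leg] := compact_sup_attained _ _ E0 cE cg.
by have [y Ey /le_trans] := fg x Ex; apply; rewrite lerD2r leg.
Qed.

Lemma time_changes_tail {R : realType} {p : nat} (lo hi : 'rV[R]_p.+1) l :
  time_changes lo hi l ->
  time_changes (vtail lo) (vtail hi) (fun k => l (lift ord0 k)).
Proof. by move=> lP k; rewrite !vtailE; exact: lP. Qed.

Lemma vtail_act {R : realType} {p : nat} (l : 'I_p.+1 -> R -> R) x :
  vtail (time_changes_act l x) =
  time_changes_act (fun k => l (lift ord0 k)) (vtail x).
Proof. by apply/rowP => k; rewrite !mxE. Qed.

(** Two indices with equal values would both attain the maximum over the pair they form. *)
Lemma unique_max_index_inj {R : realType} (M : int -> R) :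
  unique_max_index M -> injective M.
Proof.
move=> uM i j Mij; have [||k [_ ku]] := uM [set i; j].
- exact: finite_set2.
- by exists i; left.
have supM : sup (M @` [set i; j]) = M i.
  by rewrite image_setU !image_set1 Mij setUid sup1.
have <- : k = i by apply: ku; split; [left|].
by apply: ku; split; [right|rewrite supM].
Qed.

Lemma int_segmentP (i j k : int) : i <= k <= j ->
  exists h : 'I_(`|j - i|.+1), k = i + h%:Z.
Proof.
move=> ikj; have h : (`|k - i| < `|j - i|.+1)%N by lia.
by exists (Ordinal h) => /=; lia.
Qed.

(** Only finitely many pairs of indices are involved, so the conditions on [d] hold jointly for all
    small positive [d]. *)
Lemma injective_gap {R : realType} (M : int -> R) (i j : int) : injective M ->
  exists2 d : R, 0 < d &
    forall k h, i <= k <= j -> i <= h <= j -> k != h -> d <= `|M k - M h|.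
Proof.
move=> Minj; pose N := `|j - i|.+1.
have : \forall d \near 0^'+, forall kh : 'I_N * 'I_N,
    kh.1 != kh.2 -> d <= `|M (i + kh.1%:Z) - M (i + kh.2%:Z)|.
  apply: filter_forall => -[k h] /=; have [->|kh] := eqVneq k h; first by near=> d.
  have gt0 : 0 < `|M (i + k%:Z) - M (i + h%:Z)|.
    rewrite normr_gt0 subr_eq0; apply: contra kh => /eqP/Minj/addrI[kh].
    exact/eqP/val_inj.
  by near=> d => _; near: d; exact: nbhs_right_le.
move=> H; have [d [d0 dP]] := filter_ex (filterI (nbhs_right_gt (0 : R)) H).
exists d => // k h /int_segmentP[k' ->] /int_segmentP[h' ->] kh.
by apply: (dP (k', h')); apply: contra kh => /= /eqP->.
Unshelve. all: by end_near. Qed.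

Lemma argmax_segment {R : realType} (M : int -> R) (i j : int) : i <= j ->
  exists2 k, i <= k <= j & forall h, i <= h <= j -> M h <= M k.
Proof.
move=> ij; pose F (k : 'I_(`|j - i|.+1)) := M (i + k%:Z).
have [k _ kmax] := @Order.TotalTheory.arg_maxP _ _ _ (ord0 : 'I_(`|j - i|.+1))
  predT F isT.
exists (i + k%:Z); first by have := ltn_ord k; lia.
by move=> h /int_segmentP[h' ->]; exact: kmax.
Qed.

(** * The limit pair and its finitely many relevant pieces *)

Section Limit.
Context {R : realType} {p : nat} {lo hi : 'rV[R]_p.+1}.
Context {psi0 : 'rV[R]_p.+1 -> R} {tpsi0 : R -> R}.
Context {a : int -> R} {V : int -> 'rV[R]_p -> R}.
Hypothesis lohi : forall k, lo 0 k < hi 0 k.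
Hypothesis psi0J : form_J_for lo hi psi0 tpsi0 a V.
Hypothesis V_unique : forall j, unique_maximizer (rect2 lo hi) (V j).
Hypothesis sup_unique : unique_max_index (fun j => sup (V j @` rect2 lo hi)).
Hypothesis no_jump : no_jump_at_endpoints lo hi a.

Local Notation I := `[lo 0 0, hi 0 0].
Local Notation K := (rect lo hi).
Local Notation K2 := (rect2 lo hi).
Local Notation M j := (sup (V j @` K2)).
Local Notation jlo := (pidx a (lo 0 0)).
Local Notation jhi := (pidx a (hi 0 0)).

Let ja : jump_seq a. Proof. by case: psi0J => -[]. Qed.

Let Vcont j : {within K2, continuous (V j)}.
Proof. by case: psi0J => -[]. Qed.

Let psi0E x : K x -> psi0 x = V (pidx a (x 0 0)) (vtail x).
Proof.
by case: psi0J => -[_ _ + _] => /[apply] ->; exact: jump_expansionE.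
Qed.

Let tpsi0E t : t \in I -> tpsi0 t = `|pidx a t|%N%:R.
Proof.
rewrite in_itv => tI; case: psi0J => _ /counts_jumpsE; apply; first exact: ja.
exact: tI.
Qed.

Let lo_hi : lo 0 0 <= hi 0 0. Proof. exact: ltW. Qed.


Let K2_neq0 : K2 !=set0.
Proof. by exists (vtail lo) => k; rewrite !vtailE lexx ltW. Qed.

Let K2_compact : compact K2. Proof. exact: rect_compact. Qed.

Let M_ge j xi : K2 xi -> V j xi <= M j.
Proof. exact: (compact_sup_attained _ _ K2_neq0 K2_compact (Vcont j)).2. Qed.

Let pidx_in t : t \in I -> jlo <= pidx a t <= jhi.
Proof. by rewrite in_itv /= => /andP[lt th]; rewrite !pidx_le. Qed.

(** * A compatible pair close to the limit pair *)

Section Perturbation.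
Context {psi : 'rV[R]_p.+1 -> R} {tpsi : R -> R} {lam : 'I_p.+1 -> R -> R}.
Context {tlam : R -> R} {e d : R}.
Hypothesis psi_tpsi : compatible lo hi psi tpsi.
Hypothesis lamP : time_changes lo hi lam.
Hypothesis tlamP : time_change (lo 0 0) (hi 0 0) tlam.
Hypothesis psi_close : forall x, K x -> `|psi x - psi0 (time_changes_act lam x)| < e.
Hypothesis tpsi_close : forall t, t \in I -> `|tpsi t - tpsi0 (tlam t)| < 1.
Hypothesis gap : forall k h, jlo <= k <= jhi -> jlo <= h <= jhi -> k != h ->
  d <= `|M k - M h|.
Hypothesis ed : e * 2 < d.

Let lam0P : time_change (lo 0 0) (hi 0 0) (lam 0). Proof. exact: lamP. Qed.

Local Notation lam2 := (time_changes_act (fun k => lam (lift ord0 k))).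

Let lam2_in xi : K2 xi -> K2 (lam2 xi).
Proof. exact: (time_changes_act_rect (time_changes_tail _ _ _ lamP)). Qed.

Let lam2_onto xi : K2 xi -> exists2 z, K2 z & lam2 z = xi.
Proof. exact: (time_changes_act_onto (time_changes_tail _ _ _ lamP)). Qed.

Let K_vcons t xi : t \in I -> K2 xi -> K (vcons t xi).
Proof. by rewrite in_itv => tI xiK; apply/rectE; rewrite vcons_head vtail_vcons. Qed.

Lemma psi_close_vcons t xi : t \in I -> K2 xi ->
  `|psi (vcons t xi) - V (pidx a (lam 0 t)) (lam2 xi)| < e.
Proof.
move=> tI xiK; have xK := K_vcons _ _ tI xiK; have := psi_close _ xK.
rewrite psi0E; last exact: time_changes_act_rect.
by rewrite vtail_act vtail_vcons mxE vcons_head.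
Qed.

(* The jumps of psi, those of tpsi and those of psi0 \o lam correspond: the
   second are in bijection with those of tpsi0 and contain the third. *)
Lemma perturbed_piece j : jlo <= j <= jhi -> exists W : 'rV[R]_p -> R,
  {within K2, continuous W} /\
  forall x, K x -> pidx a (lam 0 (x 0 0)) = j -> psi x = W (vtail x).
Proof.
move=> jI; have [b [U [[jb Ucont psiE] /counts_jumpsE tpsiE]]] := psi_tpsi.
have {}psiE x : K x -> psi x = U (pidx b (x 0 0)) (vtail x).
  by move=> xK; rewrite psiE // jump_expansionE.
(* Both sides are natural numbers whose distance is below 1. *)
have absE : {in I, forall t, `|pidx a (tlam t)|%N = `|pidx b t|%N}.
  move=> t tI; have := tpsi_close t tI.
  rewrite tpsi0E ?(time_change_in tlamP) // tpsiE; [|exact: jb|]; last first.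
    by move: tI; rewrite in_itv.
  set m := `|pidx b t|%N; set n := `|pidx a _|%N; rewrite ltr_norml => /andP[mn nm].
  have : (n < m + 1)%N by rewrite -(ltr_nat R) natrD; lra.
  have : (m < n + 1)%N by rewrite -(ltr_nat R) natrD; lra.
  by clear; lia.
have step_a l (lP : time_change (lo 0 0) (hi 0 0) l) := step_function_pidx lP a ja.
have step_b := step_function_pidx (time_change_id (lo 0 0) (hi 0 0)) b jb.
(* If [tlam s] and [tlam t] share a piece, [psi] has the same slice at [s] and [t]. The functions
   [V i] and [V h] then differ by less than [e * 2], and so do their suprema up to equality, against
   the gap [d]. *)
have refine : {in I &, forall s t, pidx a (tlam s) = pidx a (tlam t) ->
    pidx a (lam 0 s) = pidx a (lam 0 t)}.
  move=> s t sI tI /(step_function_absz _ _ _ _ (step_a _ tlamP) step_b absE _ _ sI tI) bst.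
  have := gap _ _ (pidx_in _ (time_change_in lam0P _ sI))
                  (pidx_in _ (time_change_in lam0P _ tI)).
  set i := pidx a (lam 0 s); set h := pidx a (lam 0 t).
  have [//|ne /(_ isT)] := eqVneq i h.
  have close xi : K2 xi -> `|V i xi - V h xi| < e * 2.
    move=> /lam2_onto[z zK <-].
    have := psi_close_vcons _ _ sI zK; have := psi_close_vcons _ _ tI zK.
    rewrite !psiE; [|exact: K_vcons|exact: K_vcons].
    rewrite !vcons_head !vtail_vcons -/i -/h bst !ltr_norml; lra.
  have le1 : M i <= M h + e * 2.
    apply: sup_le_shift => // xi xiK; exists xi => //.
    by have := close xi xiK; rewrite ltr_norml; lra.
  have le2 : M h <= M i + e * 2.
    apply: sup_le_shift => // xi xiK; exists xi => //.
    by have := close xi xiK; rewrite ltr_norml; lra.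
  by rewrite real_ler_normr ?num_real // => /orP[dle|dle]; exfalso; have := ed; lra.
(* The time changes [tlam] and [lam 0] come from two separate distances, but both fix the endpoints,
   so the two step functions agree there and refinement forces equality. *)
have same : {in I, (fun t => pidx a (tlam t)) =1 (fun t => pidx a (lam 0 t))}.
  apply: step_function_eq => //; [exact: step_a|exact: step_a| |].
    by rewrite (time_change_left tlamP) // (time_change_left lam0P).
  by rewrite (time_change_right tlamP) // (time_change_right lam0P).
have [s sI sj] := pidx_ivt _ _ _ _ ja lo_hi jI.
have [t0 t0I t0s] : exists2 t, t \in I & lam 0 t = s.
  by apply: (time_change_onto lam0P); rewrite in_itv.
exists (U (pidx b t0)); split=> [|x xK xj]; first exact: Ucont.
have xI : x 0 0 \in I by have [+ _] := (rectE _ _ _).1 xK; rewrite in_itv.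
rewrite psiE //; congr U.
apply: (step_function_absz _ _ _ _ (step_a _ tlamP) step_b absE) => //.
by rewrite !same // xj t0s sj.
Qed.

Context {j : int}.
Hypothesis jI : jlo <= j <= jhi.
Hypothesis jmax : forall h, jlo <= h <= jhi -> M h <= M j.

Local Notation l0 := (Num.max (brk a j) (lo 0 0)).
Local Notation r0 := (Num.min (brk a (j + 1)) (hi 0 0)).

(** If [brk a j] were the right endpoint, piece [j] would meet the edge in a single point; the
    absence of jumps there excludes this. *)
Let l0r0 : l0 < r0.
Proof.
have brk_hi : brk a j != hi 0 0.
  by rewrite /brk; case: ifP => j0; have [] := no_jump (if 0 < j then j else j - 1);
     rewrite j0 //; lia.
rewrite gt_max !lt_min brk_lt ?ltrDl //= lohi andbT.
rewrite lt_neqAle brk_hi -le_pidx // -pidx_lt //; lia.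
Qed.

(** The plateau of [psi] is the preimage under [lam 0] of piece [j], clipped to the edge and
    carrying the largest supremum. *)
Lemma perturbed_argmax :
  [/\ K2 (vtail (sargmax lo hi psi)),
      sargmax lo hi psi 0 0 \in I /\ lam 0 (sargmax lo hi psi 0 0) = l0 &
      M j - e * 2 < V j (lam2 (vtail (sargmax lo hi psi)))] /\
  [/\ K2 (vtail (largmax lo hi psi)),
      largmax lo hi psi 0 0 \in I /\ lam 0 (largmax lo hi psi 0 0) = r0 &
      M j - e * 2 < V j (lam2 (vtail (largmax lo hi psi)))].
Proof.
have [W [Wcont WE]] := perturbed_piece j jI.
have l0_in : l0 \in I.
  by rewrite in_itv /= le_max lexx orbT ge_max lo_hi andbT -le_pidx //; lia.
have r0_in : r0 \in I.
  rewrite in_itv /= ge_min lexx orbT andbT le_min lo_hi andbT ltW //.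
  by rewrite -pidx_lt //; lia.
have [l lI ll0] := time_change_onto lam0P _ l0_in.
have [r rI rr0] := time_change_onto lam0P _ r0_in.
pose D : set R := [set t | t \in I /\ pidx a (lam 0 t) = j].
have lr : l < r by rewrite -(time_change_lt lam0P) // ll0 rr0.
have Dsub t : D t -> l <= t <= r.
  move=> [tI /eqP]; rewrite eq_sym pidx_eq // => /andP[jt tj].
  have := time_change_in lam0P _ tI; rewrite in_itv /= => /andP[lot thi].
  rewrite -(time_change_le lam0P l t) // -(time_change_le lam0P t r) //.
  by rewrite ll0 rr0 ge_max le_min jt lot thi andbT ltW.
have subD t : l <= t < r -> D t.
  move=> /andP[lt tr]; have tI : t \in I.
    by apply: in_sub_itv lI rI _; rewrite lt ltW.
  split=> //; apply/eqP; rewrite eq_sym pidx_eq //.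
  move: lt tr.
  rewrite -(time_change_le lam0P l t) // -(time_change_lt lam0P t r) //.
  by rewrite ll0 rr0 ge_max lt_min => /andP[-> _] /andP[-> _].
have psiD x : K x -> D (x 0 0) -> psi x = W (vtail x) by move=> xK [_]; exact: WE.
(* Off [D] another piece is met, whose supremum is at most [M j - d]; the closeness to [psi0] costs
   [e]. *)
have psiND x : K x -> ~ D (x 0 0) -> psi x <= M j - d + e.
  move=> xK nD; have [x0 xtK] := (rectE _ _ _).1 xK.
  have xI : x 0 0 \in I by rewrite in_itv.
  have := psi_close _ xK; rewrite psi0E; last exact: time_changes_act_rect.
  rewrite vtail_act mxE; set h := pidx a _.
  have hI : jlo <= h <= jhi by exact: pidx_in (time_change_in lam0P _ xI).
  have hj : h != j by apply/eqP => hj; exact: nD.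
  have := M_ge h _ (lam2_in _ xtK); have := gap _ _ hI jI hj.
  rewrite ler0_norm ?subr_le0 ?jmax // ltr_norml; lra.
(* Read off on the slice at [l], which belongs to [D]. *)
have WV xi : K2 xi -> `|W xi - V j (lam2 xi)| < e.
  move=> xiK; have [_ Dl] := subD l (introT andP (conj (lexx l) lr)).
  have lxiK := K_vcons _ _ lI xiK.
  have := psi_close_vcons _ _ lI xiK; rewrite Dl psiD // ?vtail_vcons //.
  by rewrite vcons_head; apply: subD; rewrite lexx.
have supW : M j - e < sup (W @` K2).
  have [[z zK Vz] _] := compact_sup_attained _ _ K2_neq0 K2_compact (Vcont j).
  have [y yK yz] := lam2_onto _ zK.
  have := (compact_sup_attained _ _ K2_neq0 K2_compact Wcont).2 _ yK.
  by have := WV _ yK; rewrite yz Vz ltr_norml; lra.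
have mM : M j - d + e < sup (W @` K2) by move: supW; have := ed; lra.
have lol : lo 0 0 <= l by move: lI; rewrite in_itv => /andP[].
have rhi : r <= hi 0 0 by move: rI; rewrite in_itv => /andP[].
(* One [e] comes from comparing [sup W] with [M j], the other from comparing [W] with [V j]. *)
have conclude x : K2 (vtail x) -> W (vtail x) = sup (W @` K2) ->
    M j - e * 2 < V j (lam2 (vtail x)).
  by move=> xK Wx; have := WV _ xK; rewrite Wx ltr_norml; move: supW; lra.
have [sK sl Ws] := sargmax_plateau lohi lol lr rhi Dsub subD Wcont psiD psiND mM.
have [tK tr Wt] := largmax_plateau lohi lol lr rhi Dsub subD Wcont psiD psiND mM.
by split; split; rewrite ?sl ?tr //; exact: conclude.
Qed.

End Perturbation.

(** The targets [S] and [L] combine the ends of the best piece with the unique maximizer of its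
    [V j]. The radius 1 for [tpsi] suffices because the values are integers. *)
Lemma argmax_stable : exists S L : 'rV[R]_p.+1, forall eta, 0 < eta ->
  exists2 e, 0 < e & forall psi tpsi, compatible lo hi psi tpsi ->
    (dK lo hi psi psi0 < e%:E)%E ->
    (dK1 (lo 0%R 0%R) (hi 0%R 0%R) tpsi tpsi0 < 1%:E)%E ->
    (forall k, `|sargmax lo hi psi 0 k - S 0 k| < eta) /\
    (forall k, `|largmax lo hi psi 0 k - L 0 k| < eta).
Proof.
have [d d0 gap] := injective_gap _ jlo jhi (unique_max_index_inj _ sup_unique).
have [j jI jmax] := argmax_segment (fun j => M j) jlo jhi (pidx_le _ _ _ ja lo_hi).
have [z [[zK Vz] zu]] := V_unique j.
exists (vcons (Num.max (brk a j) (lo 0 0)) z),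
  (vcons (Num.min (brk a (j + 1)) (hi 0 0)) z) => eta eta0.
have eta2 : 0 < eta / 2 by rewrite divr_gt0.
have [d' [d'0 d'P]] := filter_ex (filterI (nbhs_right_gt (0 : R))
  (near_unique_maximizer _ _ z _ K2_compact (Vcont j) zK Vz
     (fun x xK xM => esym (zu x (conj xK xM))) eta2)).
have small k : \forall e \near (0 : R)^'+, (expR e - 1) * (hi 0 k - lo 0 k) < eta / 2.
  have : (expR e - 1) * (hi 0 k - lo 0 k) @[e --> (0 : R)] -->
      (expR 0 - 1) * (hi 0 k - lo 0 k).
    apply: cvgM; last exact: cvg_cst.
    by apply: cvgB; [exact: continuous_expR|exact: cvg_cst].
  rewrite expR0 subrr mul0r => /cvg_at_right_filter/cvgr_lt; exact.
have d2 : 0 < d / 2 by rewrite divr_gt0.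
have d'2 : 0 < d' / 2 by rewrite divr_gt0.
(* The bound [d / 2] separates the pieces, [d' / 2] localizes the tail near [z], and the last
   condition keeps [lam] within [eta / 2] of the identity. *)
have [e [[e0 ed] [ed' esmall]]] := filter_ex (filterI
  (filterI (nbhs_right_gt (0 : R)) (nbhs_right_lt d2))
  (filterI (nbhs_right_lt d'2) (filter_forall _ small))).
exists e => // psi tpsi psi_tpsi dpsi dtpsi.
have [lam [lamP lamn close]] := dK_lt _ _ _ _ _ _ lohi dpsi.
have dist k t : t \in `[lo 0 k, hi 0 k] -> `|lam k t - t| < eta / 2.
  by move=> tI; apply: le_lt_trans (time_change_dist _ _ _ _ _ (lamP k) (lamn k) tI) (esmall k).
have [|tl [tlP _ tclose]] := dK_lt _ _ _ _ _ _ _ dtpsi; first by move=> k; rewrite !mxE.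
have tlam : time_change (lo 0 0) (hi 0 0) (tl 0) by have := tlP 0; rewrite !mxE.
have {}tclose t : t \in `[lo 0 0, hi 0 0] -> `|tpsi t - tpsi0 (tl 0 t)| < 1.
  move=> tI; have := tclose (const_mx t); rewrite !mxE; apply => k.
  by rewrite !mxE; move: tI; rewrite in_itv.
have ed2 : e * 2 < d by rewrite -ltr_pdivlMr.
have ed'2 : e * 2 < d' by rewrite -ltr_pdivlMr.
(* In the tail, one [eta / 2] moves [x] to its image under [lam] and the other moves that image to
   [z]; the first coordinate costs only one. *)
have near_target x t : K2 (vtail x) -> x 0 0 \in I /\ lam 0 (x 0 0) = t ->
    M j - e * 2 < V j (time_changes_act (fun k => lam (lift ord0 k)) (vtail x)) ->
    forall k, `|x 0 k - vcons t z 0 k| < eta.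
  move=> xK [x0I x0t] Vx k; have [i ->|->] := unliftP ord0 k; last first.
    rewrite vcons_head -x0t distrC; apply: lt_trans (dist _ _ x0I) _.
    by rewrite ltr_pdivrMr // ltr_pMr // ltr1n.
  rewrite -!vtailE vtail_vcons.
  have yK := time_changes_act_rect (time_changes_tail _ _ _ lamP) _ xK.
  have := d'P _ yK (lt_trans _ Vx) i; rewrite ltrD2l ltrN2 => /(_ ed'2).
  have := dist (lift ord0 i) (vtail x 0 i).
  rewrite in_itv -!(vtailE lo) -!(vtailE hi) => /(_ (xK i)).
  rewrite [time_changes_act _ _ _ _]mxE !ltr_norml; lra.
have [[sK sl Vs] [rK rl Vr]] :=
  perturbed_argmax psi_tpsi lamP tlam close tclose gap ed2 jI jmax.
by split; exact: near_target.
Qed.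

End Limit.

(** * Passage to sequences *)

Lemma dK_refl_le0 {R : realType} n (lo hi : 'rV[R]_n.+1) f : (dK lo hi f f <= 0)%E.
Proof.
apply: (@le_trans _ _ (time_changes_norm lo hi (fun=> id) +
    ereal_sup [set `|f x - f (time_changes_act (fun=> id) x)|%:E | x in rect lo hi])%E).
  by apply: ereal_inf_lbound; exists (fun=> id) => // k; exact: time_change_id.
rewrite -[leRHS]adde0; apply: leeD.
  apply/bigmax_leP; split; first exact: leNye.
  move=> k _; apply: ge_ereal_sup => _ [[s t] [_ _ /= st] <-].
  by rewrite divff ?ln1 ?normr0 // subr_eq0 eq_sym.
apply: ge_ereal_sup => _ [x _ <-].
have -> : time_changes_act (fun=> id) x = x by apply/rowP => k; rewrite mxE.
by rewrite subrr normr0.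
Qed.

Lemma cvge0_lt {R : realType} (u : nat -> \bar R) (e : R) : 0 < e ->
  u n @[n --> \oo] --> 0%E -> \forall n \near \oo, (u n < e%:E)%E.
Proof.
move=> e0 /fine_cvgP[ufin /cvgr_lt/(_ _ e0) ue].
near=> n; rewrite -[u n]fineK ?lte_fin; near: n => //.
Unshelve. all: by end_near. Qed.

(** Stability applies to [psi 0] itself, at distance 0 from [psi 0]; both extremal maximizers are
    thus within [eta / 2] of common targets, which need not be identified. *)
Lemma cvg_argmax {R : realType} {p : nat} (lo hi : 'rV[R]_p.+1)
    (psi : nat -> 'rV[R]_p.+1 -> R) (tpsi : nat -> R -> R) a V :
  (forall k, lo 0 k < hi 0 k) ->
  (forall n, compatible lo hi (psi n) (tpsi n)) ->
  dK lo hi (psi n) (psi 0%N) @[n --> \oo] --> 0%E ->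
  dK1 (lo 0 0) (hi 0 0) (tpsi n) (tpsi 0%N) @[n --> \oo] --> 0%E ->
  form_J_for lo hi (psi 0%N) (tpsi 0%N) a V ->
  (forall j, unique_maximizer (rect2 lo hi) (V j)) ->
  unique_max_index (fun j => sup (V j @` rect2 lo hi)) ->
  no_jump_at_endpoints lo hi a ->
  sargmax lo hi (psi n) @[n --> \oo] --> sargmax lo hi (psi 0%N) /\
  largmax lo hi (psi n) @[n --> \oo] --> largmax lo hi (psi 0%N).
Proof.
move=> lohi psi_tpsi dpsi dtpsi psi0J Vu Mu nj.
have [S [L SL]] := argmax_stable lohi psi0J Vu Mu nj.
suff close eta : 0 < eta -> \forall n \near \oo,
    (forall k, `|sargmax lo hi (psi n) 0 k - sargmax lo hi (psi 0%N) 0 k| < eta) /\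
    (forall k, `|largmax lo hi (psi n) 0 k - largmax lo hi (psi 0%N) 0 k| < eta).
  split; apply/cvg_rowP => eta /close; apply: filterS => n [].
    by [].
  by [].
move=> eta0; have eta2 : 0 < eta / 2 by rewrite divr_gt0.
have [e e0 eP] := SL _ eta2.
have [|||S0 L0] := eP (psi 0%N) (tpsi 0%N) => //.
- by rewrite (le_lt_trans (dK_refl_le0 _ _ _ _)) ?lte_fin.
- by rewrite (le_lt_trans (dK_refl_le0 _ _ _ _)) ?lte_fin.
apply: filterS2 (cvge0_lt _ _ e0 dpsi) (cvge0_lt _ _ ltr01 dtpsi) => n dn dtn.
have [Sn Ln] := eP _ _ (psi_tpsi n) dn dtn.
split=> k; [move: (S0 k) (Sn k)|move: (L0 k) (Ln k)]; rewrite !ltr_norml; lra.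
Qed.

Theorem theorem3p1 (R : realType) :
  (* dimension q + 2 >= 2 *)
  (forall (q : nat) (lo hi : 'rV[R]_q.+2)
     (psi : nat -> 'rV[R]_q.+2 -> R) (tpsi : nat -> R -> R)
     (a : int -> R) (V : int -> 'rV[R]_q.+1 -> R),
     (forall k, lo 0 k < hi 0 k) ->
     (forall n, DK0 lo hi (psi n)) ->
     (forall n, Sspace_on (rect1 lo hi) (tpsi n)) ->
     (forall n, compatible lo hi (psi n) (tpsi n)) ->
     dK lo hi (psi n) (psi 0%N) @[n --> \oo] --> 0%E ->
     dK1 (lo 0 0) (hi 0 0) (tpsi n) (tpsi 0%N) @[n --> \oo] --> 0%E ->
     form_J_for lo hi (psi 0%N) (tpsi 0%N) a V ->
     (forall j, unique_maximizer (rect2 lo hi) (V j)) ->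
     unique_max_index (fun j => sup (V j @` rect2 lo hi)) ->
     no_jump_at_endpoints lo hi a ->
     sargmax lo hi (psi n) @[n --> \oo] --> sargmax lo hi (psi 0%N) /\
     largmax lo hi (psi n) @[n --> \oo] --> largmax lo hi (psi 0%N))
  /\
  (* dimension 1 *)
  (forall (lo hi : 'rV[R]_1)
     (psi : nat -> 'rV[R]_1 -> R) (tpsi : nat -> R -> R)
     (a : int -> R) (V : int -> R),
     (forall k, lo 0 k < hi 0 k) ->
     (forall n, DK0 lo hi (psi n)) ->
     (forall n, Sspace_on (rect1 lo hi) (tpsi n)) ->
     (forall n, compatible lo hi (psi n) (tpsi n)) ->
     dK lo hi (psi n) (psi 0%N) @[n --> \oo] --> 0%E ->
     dK1 (lo 0 0) (hi 0 0) (tpsi n) (tpsi 0%N) @[n --> \oo] --> 0%E ->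
     form_J_for lo hi (psi 0%N) (tpsi 0%N) a (fun j _ => V j) ->
     unique_max_index V ->
     no_jump_at_endpoints lo hi a ->
     sargmax lo hi (psi n) @[n --> \oo] --> sargmax lo hi (psi 0%N) /\
     largmax lo hi (psi n) @[n --> \oo] --> largmax lo hi (psi 0%N)).
Proof.
split=> [q|] lo hi psi tpsi a V lohi _ _ psi_tpsi dpsi dtpsi psi0J.
  exact: cvg_argmax.
move=> Vu nj.
(* In dimension 1 the tail lives in the one-point space of empty rows, so each constant is its own
   supremum, uniquely attained. *)
have K2E : rect2 lo hi = [set 0].
  apply/seteqP; split=> [x _|x _ []]; last by [].
  by apply/rowP; case.
have supV j : sup ((fun=> V j) @` rect2 lo hi) = V j.
  by rewrite K2E image_set1 sup1.
apply: (cvg_argmax lo hi psi tpsi a (fun j _ => V j)) => // [j|].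
  exists 0; rewrite K2E image_set1 sup1; split=> // x [-> _] //.
by rewrite (_ : (fun j => _) = V) //; apply/funext.
Qed.
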